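(* Let $C\in\mathbb N_+$. Suppose that for some $p\in\mathbb N_+$ there exists a $2C$-strong erasing word of length $2p$ for $(G,\phi)$. Then the finite-buffer Markov chain $(U^C_n)_{n\in\mathbb N}$ on $\mathbb W_2(C)$ is uniformly ergodic. Moreover, for any non-empty set $\mathscr S_2(p)$ of $2C$-strong erasing words of length $2p$, Algorithm 1 run with $\mathscr S_2(p)$ terminates almost surely and its output is distributed according to the stationary distribution $\pi$ of $(U^C_n)_{n\in\mathbb N}$ on $\mathbb W_2(C)$.
   Context: Model. $G=(\mathcal V,\mathcal E)$ is a finite connected simple graph; $\mathcal E(v)$ is the set of neighbors of $v$. $\mathcal V^*$ is the set of finite words over $\mathcal V$, $|w|$ the length of $w$, $|w|_i$ the number of occurrences of $i$ in $w$, $\emptyset$ the empty word. $\mathbb W=\{w\in\mathcal V^*:|w|_i|w|_j=0\ \forall (i,j)\in\mathcal E\}$ is the set of buffer contents (classes of stored items in order of arrival), $\mathbb W_2=\{w\in\mathbb W:|w|\text{ even}\}$, $\mathbb W_2(C)=\{w\in\mathbb W_2:|w|\le 2C\}$. $\mathcal S=\prod_{i\in\mathcal V}S_{\mathcal E(i)}$ is the set of lists of preferences ($S_A$ = permutations of $A$). An admissible matching policy $\phi$ consists of a probability distribution $\nu_\phi$ on $\mathcal S$ and a map $\odot_\phi:\mathbb W\times(\mathcal V\times\mathcal S)\to\mathbb W$ such that $w\odot_\phi(v,\sigma)=wv$ if no letter of $w$ lies in $\mathcal E(v)$, and otherwise $w\odot_\phi(v,\sigma)$ is $w$ with one letter belonging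 to $\mathcal E(v)$ deleted, the deleted position being a function of $(w,v,\sigma)$. For $z=v_1\cdots v_n$, $\varsigma=\sigma_1\cdots\sigma_n$, $W_\phi(z,\varsigma)$ is obtained from $\emptyset$ by applying successively $\odot_\phi(v_1,\sigma_1),\dots,\odot_\phi(v_n,\sigma_n)$. $\mu$ is a probability measure on $\mathcal V$ with full support, and the arrivals $(V_n,\Sigma_n)_{n\in\mathbb Z}$ are i.i.d. of law $\mu\otimes\nu_\phi$. Strong erasing words. A word $z\in\mathcal V^*$ of even length $2p$ is a $2C$-strong erasing word for $(G,\phi)$ if (i) for every $w\in\mathbb W_2(C)$ and all $\varsigma,\varsigma'\in\mathcal S^*$ of lengths $|w|$ and $2p$ whose letters have positive $\nu_\phi$-probability, $W_\phi(wz,\varsigma\varsigma')=\emptyset$; and (ii) for every prefix $\breve z$ of $z$ of even length $2r$, every $w\in\mathbb W_2(C)$ and all $\varsigma,\breve\varsigma'\in\mathcal S^*$ of lengths $|w|$ and $2r$ whose letters have positive $\nu_\phi$-probability, $|W_\phi(w\breve z,\varsigma\breve\varsigma')|\le|W_\phi(w,\varsigma)|$. Finite-buffer chain. Items arrive by successive pairs; the buffer has size $2C$. For $u\in\mathbb W_2(C)$ and a pair $(v,\sigma),(v',\sigma')$, the next state is $u'=(u\odot_\phi(v,\sigma))\odot_\phi(v',\sigma')$ if $|u'|\le 2C$, and is $u$ otherwise (the buffer is full and the two arriving items, incompatible with every stored item and with each other, are both discarded). $(U^C_n)$ is the Markov chain so obtained when the $n$-th pair is $(V_{2n},\Sigma_{2n}),(V_{2n+1},\Sigma_{2n+1})$.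 Uniformly ergodic means that the law of $U^C_n$ converges in total variation to $\pi$ uniformly in the initial state. Algorithm 1. Draw arrivals backwards in time, two by two: $(V_{2j},\Sigma_{2j},V_{2j+1},\Sigma_{2j+1})$ for $j=-1,-2,\dots$, independent of law $\mu\otimes\nu_\phi\otimes\mu\otimes\nu_\phi$, until the first $n\ge p$ such that the word $V_{-2n}V_{-2n+1}\cdots V_{-2n+2p-1}$ belongs to $\mathscr S_2(p)$. Then set the buffer content to $\emptyset$ at even time $-n+p$ (just after this word has arrived), and update it with the finite-buffer dynamics using the already drawn pairs of indices $j=-n+p,\dots,-1$. Return the resulting buffer content at time $0$. *)

(* Defs.v *)
From HB Require Import structures.
From mathcomp Require Import all_boot all_order all_algebra all_fingroup.
From mathcomp Require Import all_classical all_reals all_analysis.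

Set Implicit Arguments.
Unset Strict Implicit.
Unset Printing Implicit Defensive.

Import Order.TTheory GRing.Theory Num.Theory.
Import numFieldNormedType.Exports.

Local Open Scope ring_scope.

Definition is_distr (R : realType) (T : finType) (f : T -> R) : Prop :=
  (forall x, 0 <= f x) /\ \sum_x f x = 1.

Definition tv_dist (R : realType) (T : finType) (f g : T -> R) : R :=
  \big[Num.max/0]_(A : {set T}) `|\sum_(x in A) f x - \sum_(x in A) g x|.

Section Model.
Variables (V : finType) (e : rel V).

Definition in_W (w : seq V) : bool :=
  [forall i, forall j, e i j ==> (count_mem i w * count_mem j w == 0)%N].

Record buffer := Buffer { bword :> seq V; bwordP : in_W bword }.
HB.instance Definition _ := [isSub for bword].
HB.instance Definition _ := [Countable of buffer by <:].

Lemma in_W_nil : in_W [::].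
Proof. by apply/forallP => i; apply/forallP => j; apply/implyP. Qed.

Definition empty : buffer := Buffer in_W_nil.

(* S_A is the group Sym A of the permutations of V with support in A. *)
Definition prefs : finType :=
  {s : {ffun V -> {perm V}} | [forall i, s i \in Sym [set j | e i j]]}.

Definition arrival : finType := (V * prefs)%type.

(* The deleted position k is a function of (w, v, s), because odot is one. *)
Record policy (R : realType) := Policy {
  nu : prefs -> R;
  nu_distr : is_distr nu;
  odot : buffer -> arrival -> buffer;
  odot_store : forall (w : buffer) v s, ~~ has (e v) w ->
    odot w (v, s) = rcons w v :> seq V;
  odot_match : forall (w : buffer) v s, has (e v) w ->
    exists k, [/\ (k < size w)%N, e v (nth v w k)
                & odot w (v, s) = take k w ++ drop k.+1 w :> seq V]
}.

(* The elements of W_2(C); C.*2.-bseq V is the finite type of the words of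
   length at most 2C. *)
Record state (C : nat) := State {
  sword : C.*2.-bseq V;
  swordP : in_W sword && ~~ odd (size sword)
}.
HB.instance Definition _ C := [isSub for @sword C].
HB.instance Definition _ C := [Finite of state C by <:].

Definition sbuf C (u : state C) : buffer := Buffer (proj1 (andP (swordP u))).

Lemma state0P C :
  in_W (Bseq (leq0n C.*2 : size (Nil V) <= C.*2)%N) && ~~ odd (size (Nil V)).
Proof. by rewrite in_W_nil. Qed.

Definition state0 C : state C := State (state0P C).

Section Policy.
Variables (R : realType) (phi : policy R).

Definition W_phi (z : seq V) (s : seq prefs) : buffer :=
  foldl (odot phi) empty (zip z s).

Definition nu_pos (s : seq prefs) : bool := all (fun x => 0 < nu phi x) s.

Definition strong_erasing (C : nat) (z : seq V) : Prop :=
  [/\ ~~ odd (size z),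
      forall (w : state C) (s s' : seq prefs),
        size s = size (sbuf w) -> size s' = size z ->
        nu_pos s -> nu_pos s' ->
        W_phi (sbuf w ++ z) (s ++ s') = empty
    & forall (zb : seq V), prefix zb z -> ~~ odd (size zb) ->
      forall (w : state C) (s s' : seq prefs),
        size s = size (sbuf w) -> size s' = size zb ->
        nu_pos s -> nu_pos s' ->
        (size (W_phi (sbuf w ++ zb) (s ++ s')) <= size (W_phi (sbuf w) s))%N].

Definition step2 C (u : state C) (x y : arrival) : buffer :=
  odot phi (odot phi (sbuf u) x) y.

Lemma odd_odot (w : buffer) (x : arrival) :
  odd (size (odot phi w x)) = ~~ odd (size w).
Proof.
case: x => v s; have [vw|vw] := boolP (has (e v) w); last first.
  by rewrite (odot_store phi s vw) size_rcons.
have [k [kw _ ->]] := odot_match phi s vw.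
by rewrite size_cat size_take size_drop kw -{2}(subnKC kw) addSn /= negbK.
Qed.

Lemma step2P C (u : state C) (x y : arrival)
    (h : (size (step2 u x y) <= C.*2)%N) :
  in_W (Bseq h) && ~~ odd (size (Bseq h)).
Proof.
rewrite (bwordP (step2 u x y)) /= !odd_odot negbK.
by case/andP: (swordP u).
Qed.

Definition next C (u : state C) (x y : arrival) : state C :=
  match @idP (size (step2 u x y) <= C.*2)%N with
  | ReflectT h => State (step2P h)
  | ReflectF _ => u
  end.

Lemma nextE C (u : state C) (x y : arrival) :
  sbuf (next u x y) =
  if (size (step2 u x y) <= C.*2)%N then step2 u x y else sbuf u.
Proof. by rewrite /next; case: {-}_ / idP => [h|h]; [apply: val_inj; rewrite /= h|rewrite ifN //; apply/negP]. Qed.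

(* Content after the k pairs of indices j, ..., j + k - 1 of the trajectory x,
   starting from u. *)
Fixpoint run C (x : int -> arrival) (j : int) (k : nat) (u : state C) :
    state C :=
  if k is k'.+1 then
    next (run x j k' u) (x (2 * (j + k'%:Z))) (x (2 * (j + k'%:Z) + 1))
  else u.

Section Algorithm.
Variables (p : nat) (S2 : {set p.*2.-tuple V}) (x : int -> arrival).

Definition drawn_word (n : nat) : p.*2.-tuple V :=
  [tuple (x (- (n.*2)%:Z + (i : nat)%:Z)).1 | i < p.*2].

Definition stops_at (n : nat) : Prop :=
  [/\ (p <= n)%N, drawn_word n \in S2
    & forall m, (p <= m < n)%N -> drawn_word m \notin S2].

Definition terminates : Prop := exists n, stops_at n.

Definition returns C (u : state C) : Prop :=
  exists2 n, stops_at n & u = run x (- n%:Z + p%:Z) (n - p) (state0 C).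

End Algorithm.

Section Chain.
Variable mu : V -> R.

Definition arrival_law (a : arrival) : R := mu a.1 * nu phi a.2.

Definition kernel C (u u' : state C) : R :=
  \sum_(a : arrival * arrival | next u a.1 a.2 == u')
     arrival_law a.1 * arrival_law a.2.

Definition stationary C (pi : state C -> R) : Prop :=
  is_distr pi /\ forall u', \sum_u pi u * kernel u u' = pi u'.

Variables (d : measure_display) (T : measurableType d) (P : probability T R).
Variable X : int -> T -> arrival.

Local Open Scope classical_set_scope.

Definition iid_arrivals : Prop :=
  [/\ forall n (A : {set arrival}), measurable (X n @^-1` [set` A]),
      forall n (A : {set arrival}),
        P (X n @^-1` [set` A]) = (\sum_(a in A) arrival_law a)%:E
    & forall (J : seq int) (A : int -> {set arrival}), uniq J ->
        P (\bigcap_(n in [set` J]) (X n @^-1` [set` A n]))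
        = (\prod_(n <- J) fine (P (X n @^-1` [set` A n])))%:E].

(* U^C_n started at u; the pair of index n drives the step from n to n + 1. *)
Definition chain C (u : state C) (n : nat) (t : T) : state C :=
  run (X^~ t) 0 n u.

Definition chain_law C (u : state C) (n : nat) (u' : state C) : R :=
  fine (P [set t | chain u n t = u']).

Definition uniformly_ergodic_to C (pi : state C -> R) : Prop :=
  (fun n => \big[Num.max/0]_(u : state C) tv_dist (chain_law u n) pi)
    @ \oo --> (0 : R).

End Chain.
End Policy.
End Model.

(* Main.v *)
Require Import Defs.
From HB Require Import structures.
From mathcomp Require Import all_boot all_order all_algebra all_fingroup.
From mathcomp Require Import all_classical all_reals all_analysis.
From mathcomp Require Import zify.

Import Order.TTheory GRing.Theory Num.Theory.
Import numFieldNormedType.Exports.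

Local Open Scope classical_set_scope.
Local Open Scope ring_scope.

Set Implicit Arguments.
Unset Strict Implicit.
Unset Printing Implicit Defensive.

(** The argument is coupling from the past.  Condition (ii) of a strong erasing
word says that, after each pair of its letters, the content is not longer than
the starting one; so the size bound of the buffer never acts while such a word
arrives, the finite-buffer dynamics follows the unbounded one, and condition
(i) then gives: a strong erasing word drives every state of the finite-buffer
chain to the empty one ([erasing_resets]).  This needs the arriving lists of
preferences to have positive probability, which they almost surely do.

Run the chain from the past time [- k] to time 0.  If the algorithm stops at
some [n <= k], the trajectory is reset by the word met at [- n], and its final
state is the output of the algorithm, whatever the initial state
([coupled_from_past]).  Hence the law at time [k] of the chain started at any
[u], which by stationarity of the arrivals is the law of the run from [- k] to
0, differs at each state from the law of the output by at most the probability
that no word of the prescribed set is met up to [k] ([run_law_close]).  That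
probability tends to 0 geometrically: the words at the depths [p], [2 p],
[3 p], ... occupy disjoint windows, so they are independent, and each of them
equals a given erasing word with the same positive probability
([blocks_miss_prob], [miss_prob_cvg0]).

So the law of the chain tends pointwise to the law of the output, from every
initial state.  Uniform ergodicity, stationarity and uniqueness are then formal
for a chain on a finite set ([limit_stationary], [limit_unique],
[limit_uniform]).  As the limit does not involve the set of erasing words, the
algorithms run with different sets have the same output law, and it is enough
to define [pi] by a set with one word.

Each probability is that of an event which involves finitely many arrivals.
Such an event is a condition on the path of arrivals that is determined by a
finite list of indices, and events determined by disjoint lists are independent
([event_indep]). *)

(** * Windows of consecutive arrival indices *)

Definition window (a : int) (m : nat) : seq int :=
  [seq a + i%:Z | i <- iota 0 m].

Lemma mem_window a m n : (n \in window a m) = (a <= n < a + m%:Z).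
Proof.
apply/mapP/andP => [[i]|[an nam]].
  by rewrite mem_iota => /andP[_ im] ->; lia.
exists `|n - a|%N; last by lia.
by rewrite mem_iota; lia.
Qed.

Lemma window_uniq a m : uniq (window a m).
Proof. by rewrite map_inj_uniq ?iota_uniq// => i j ij; lia. Qed.

Lemma window_cat_uniq a m b k :
  (a + m%:Z <= b) || (b + k%:Z <= a) -> uniq (window a m ++ window b k).
Proof.
move=> ab; rewrite cat_uniq !window_uniq andbT /=; apply/hasPn => n.
by rewrite !mem_window; lia.
Qed.

Lemma windowD a m k : window a (m + k) = window a m ++ window (a + m%:Z) k.
Proof.
rewrite /window iotaD map_cat add0n; congr (_ ++ _).
by rewrite -[m in iota m _]addn0 iotaDl -map_comp; apply: eq_map => i /=; lia.
Qed.

Lemma size_window a m : size (window a m) = m.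
Proof. by rewrite size_map size_iota. Qed.

Lemma window_pair j r : window (2 * j) r.+1.*2 =
  window (2 * j) r.*2 ++ [:: 2 * (j + r%:Z); 2 * (j + r%:Z) + 1].
Proof.
rewrite (_ : r.+1.*2 = r.*2 + 2)%N; last by rewrite doubleS addn2.
rewrite windowD; congr (_ ++ _).
by rewrite /window /=; congr [:: _; _]; lia.
Qed.

(** * Erasing words reset the finite buffer *)

Section Dynamics.
Variables (R : realType) (V : finType) (e : rel V) (phi : policy e R) (C : nat).
Implicit Types (x : int -> arrival e) (u : state e C) (b : buffer e).

(** Letters of an admissible word are pairwise compatible, so none of them
finds a match and each one is stored. *)
Lemma store_compatible b w s : in_W e (b ++ w) -> size s = size w ->
  foldl (odot phi) b (zip w s) = b ++ w :> seq V.
Proof.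
elim: w s b => [|v w IH] [|a s] b //=; first by rewrite cats0.
move=> Wbw [ssw].
have vb : ~~ has (e v) b.
  apply/hasPn => i ib; apply/negP => evi.
  move/forallP/(_ v)/forallP/(_ i)/implyP/(_ evi): Wbw.
  have : (0 < count_mem i b)%N by rewrite -has_count has_pred1.
  by rewrite !count_cat /= eqxx; lia.
have st := odot_store phi a vb.
by rewrite IH ?st ?cat_rcons.
Qed.

(** The two conditions on a strong erasing word speak of the state reached from
the empty buffer along the word [u]; this state is [u] itself. *)
Lemma W_phi_sbuf u s : size s = size (sbuf u) ->
  W_phi phi (sbuf u) s = sbuf u.
Proof.
move=> su; apply: val_inj; apply: store_compatible => //=.
exact: bwordP (sbuf u).
Qed.

(** The conditions on a strong erasing word are quantified over lists of
preferences of positive probability for [u] as well; one list is supplied. *)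
Lemma positive_pref : exists s : prefs e, 0 < nu phi s.
Proof.
have [nu0 nu1] := nu_distr phi; apply/existsP; apply: contraT.
rewrite negb_exists => /forallP nunp.
have : \sum_s nu phi s = 0.
  by apply: big1 => s _; apply/eqP; rewrite eq_le nu0 leNgt nunp.
by rewrite nu1 => /eqP; rewrite oner_eq0.
Qed.

Lemma run_add x j k l u :
  run phi x j (k + l) u = run phi x (j + k%:Z) l (run phi x j k u).
Proof.
elim: l => [|l IH]; first by rewrite addn0.
by rewrite addnS /= IH (_ : j + (k + l)%N%:Z = j + k%:Z + l%:Z)//; lia.
Qed.

Lemma W_phi_cat u s z s' : size s = size (sbuf u) ->
  W_phi phi (sbuf u ++ z) (s ++ s') = foldl (odot phi) (sbuf u) (zip z s').
Proof.
by move=> su; rewrite /W_phi zip_cat// foldl_cat -/(W_phi _ _ _) W_phi_sbuf.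
Qed.

Lemma zip_letters x (J : seq int) :
  zip [seq (x n).1 | n <- J] [seq (x n).2 | n <- J] = [seq x n | n <- J].
Proof. by elim: J => //= n J ->; case: (x n). Qed.

Definition positive_prefs x (J : seq int) : Prop :=
  {in J, forall n, 0 < nu phi (x n).2}.

(** While an erasing word arrives the buffer never overflows: by condition (ii)
the content after each pair is at most as long as the initial one.  The
finite-buffer dynamics is therefore the unbounded one. *)
Lemma run_erasing x (j : int) z r u : strong_erasing phi C z ->
  [seq (x n).1 | n <- window (2 * j) (size z)] = z ->
  positive_prefs x (window (2 * j) (size z)) ->
  (r.*2 <= size z)%N ->
  sbuf (run phi x j r u) =
  foldl (odot phi) (sbuf u) [seq x n | n <- window (2 * j) r.*2].
Proof.
move=> [zev _ zle] xz posz; elim: r => [|r IH] rz; first by [].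
have {}IH : sbuf (run phi x j r u) = _ := IH ltac:(lia).
rewrite [run _ _ _ _ _]/= Defs.nextE /step2 IH.
rewrite window_pair map_cat foldl_cat /=; set w' := odot phi _ _.
suff -> : (size w' <= C.*2)%N by [].
have [s0 s0pos] := positive_pref.
pose s := nseq (size (sbuf u)) s0.
have ss : size s = size (sbuf u) by rewrite size_nseq.
have spos : nu_pos phi s by rewrite /nu_pos all_nseq s0pos orbT.
(* J indexes the prefix of z to which condition (ii) is applied. *)
pose J := window (2 * j) r.+1.*2.
have zJ : window (2 * j) (size z) =
          J ++ window (2 * j + r.+1.*2%:Z) (size z - r.+1.*2).
  by rewrite -windowD subnKC.
have Jpos : nu_pos phi [seq (x n).2 | n <- J].
  rewrite /nu_pos all_map; apply/allP => n nJ /=; apply: posz.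
  by rewrite zJ mem_cat nJ.
have := zle [seq (x n).1 | n <- J] _ _ u s [seq (x n).2 | n <- J] ss.
rewrite W_phi_cat// W_phi_sbuf// zip_letters => wle.
apply: leq_trans (size_bseq (sword u)).
have wE : w' = foldl (odot phi) (sbuf u) [seq x n | n <- J].
  by rewrite /J window_pair map_cat foldl_cat.
rewrite wE; apply: wle => //.
- by rewrite -xz zJ map_cat prefix_prefix.
- by rewrite size_map size_window odd_double.
- by rewrite !size_map.
Qed.

(** Condition (i), carried over to the finite-buffer dynamics by [run_erasing]:
this is what couples the trajectories started from all the states. *)
Lemma erasing_resets x (j : int) p z u :
  size z = p.*2 -> strong_erasing phi C z ->
  [seq (x n).1 | n <- window (2 * j) p.*2] = z ->
  positive_prefs x (window (2 * j) p.*2) ->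
  run phi x j p u = state0 e C.
Proof.
move=> zp zse xz posz; apply: val_inj; apply: val_inj => /=.
have [_ zempty _] := zse.
have [s0 s0pos] := positive_pref.
pose s := nseq (size (sbuf u)) s0.
have ss : size s = size (sbuf u) by rewrite size_nseq.
have spos : nu_pos phi s by rewrite /nu_pos all_nseq s0pos orbT.
have := zempty u s [seq (x n).2 | n <- window (2 * j) p.*2] ss.
rewrite -{1 2}xz W_phi_cat// zip_letters -(@run_erasing x j z p u) ?zp// ?xz//.
move=> resets; apply: (congr1 (@bword V e) (resets _ spos _)).
  by rewrite size_map size_window zp.
by rewrite /nu_pos all_map; apply/allP => n nJ /=; apply: posz.
Qed.

End Dynamics.

(** * Coupling from the past along one path *)

Section Stopping.
Variables (R : realType) (V : finType) (e : rel V) (phi : policy e R) (C : nat).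
Variables (p : nat) (S2 : {set p.*2.-tuple V}).
Implicit Types (x y : int -> arrival e) (u : state e C) (n k : nat).

Lemma drawn_wordE x n :
  drawn_word p x n = [seq (x i).1 | i <- window (2 * - n%:Z) p.*2] :> seq V.
Proof.
rewrite /window -map_comp -val_enum_ord -map_comp /= ?enumT.
apply: eq_map => i /=.
by congr (x _).1; lia.
Qed.

Lemma drawn_word_local x y m n : (p <= m <= n)%N ->
  {in window (2 * - n%:Z) n.*2, x =1 y} -> drawn_word p x m = drawn_word p y m.
Proof.
move=> pmn xy; apply: val_inj; rewrite [LHS]drawn_wordE [RHS]drawn_wordE.
apply/eq_in_map => i; rewrite mem_window => iw.
by rewrite xy// mem_window; lia.
Qed.

Lemma stops_at_uniq x m n : stops_at S2 x m -> stops_at S2 x n -> m = n.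
Proof.
move=> [pm mS lem] [pn nS len]; apply/eqP; rewrite eqn_leq; apply/andP; split.
  by rewrite leqNgt; apply/negP => nm; move: (lem n);
  rewrite pn nm nS => /(_ isT).
by rewrite leqNgt; apply/negP => mn; move: (len m);
rewrite pm mn mS => /(_ isT).
Qed.

Definition hit k x : Prop :=
  exists2 m, (p <= m <= k)%N & drawn_word p x m \in S2.

Lemma hit_stops k x : hit k x -> exists2 n, (n <= k)%N & stops_at S2 x n.
Proof.
move=> [m /andP[pm mk] mS].
have ex : exists m, (p <= m)%N && (drawn_word p x m \in S2).
  by exists m; rewrite pm.
exists (ex_minn ex); case: ex_minnP => n /andP[pn nS] nmin.
  by apply: leq_trans mk; apply: nmin; rewrite pm.
split=> // i /andP[pi ni]; apply: contraTN ni => iS.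
by rewrite -leqNgt nmin// pi.
Qed.

Hypothesis S2_erasing : forall z, z \in S2 -> strong_erasing phi C z.

(** The word at depth [n] resets the run begun at [- k], which has by then some
unknown state; from the reset on, the run does what the algorithm does. *)
Lemma coupled_from_past x n k u : stops_at S2 x n -> (n <= k)%N ->
  positive_prefs phi x (window (2 * - k%:Z) k.*2) ->
  run phi x (- k%:Z) k u = run phi x (- n%:Z + p%:Z) (n - p) (state0 e C).
Proof.
move=> [pn nS _] nk pos.
(* The pairs before the erasing word, the p pairs of the word, and the pairs
   which the algorithm uses. *)
have {2}-> : k = ((k - n) + (p + (n - p)))%N by lia.
rewrite run_add run_add (_ : - k%:Z + (k - n)%N%:Z = - n%:Z); last by lia.
rewrite (erasing_resets (p := p) (z := drawn_word p x n))//.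
- by rewrite size_tuple.
- exact: S2_erasing.
- by rewrite drawn_wordE.
- by move=> i; rewrite mem_window => ni; apply: pos; rewrite mem_window; lia.
Qed.

Lemma returns_run x k u u' : hit k x ->
  positive_prefs phi x (window (2 * - k%:Z) k.*2) ->
  returns phi S2 x u' <-> run phi x (- k%:Z) k u = u'.
Proof.
move=> /hit_stops[n nk xn] pos; split=> [[m xm ->]|<-].
  by rewrite -(stops_at_uniq xn xm); apply: coupled_from_past.
by exists n => //; apply: coupled_from_past.
Qed.

End Stopping.

(** * Pointwise limits of finite chains *)

Lemma cvg_fin_sum (R : realType) (I : finType) (f : I -> nat -> R)
    (l : I -> R) :
  (forall i, f i k @[k --> \oo] --> l i) ->
  \sum_i f i k @[k --> \oo] --> \sum_i l i.
Proof. by move=> fl; apply: cvg_big => // x; exact: add_continuous. Qed.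

(** [L k] is the k-th power of the stochastic matrix [K], and the rows of these
powers all tend to the same vector [pi]. *)
Section FiniteChain.
Variables (R : realType) (S : finType) (K : S -> S -> R).
Variables (L : nat -> S -> S -> R) (pi : S -> R).
Hypothesis L0 : forall u v, L 0 u v = (u == v)%:R.
Hypothesis LS : forall k u v, L k.+1 u v = \sum_w L k u w * K w v.
Hypothesis L_distr : forall k u, is_distr (L k u).
Hypothesis L_cvg : forall u v, (fun k => L k u v) @ \oo --> pi v.

(** Pass to the limit in the unit sum of the rows and in the recursion that gives
[L k.+1] from [L k]. *)
Lemma limit_stationary (u : S) :
  is_distr pi /\ forall v, \sum_w pi w * K w v = pi v.
Proof.
split; first split.
- move=> v; refine (@cvgr_to_ge _ \oo _ _ (fun k => L k u v) _ _ _ _).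
    exact: L_cvg.
  by apply: nearW => k; have [] := L_distr k u.
- have cvg1 : (fun k => \sum_v L k u v) @ \oo --> \sum_v pi v.
    by apply: cvg_fin_sum => v; exact: L_cvg.
  apply: (cvg_unique _ cvg1) => //.
  rewrite (_ : (fun k => _) = fun=> 1); first exact: cvg_cst.
  by apply/funext => k; have [] := L_distr k u.
- move=> v; have cvgS : (fun k => L k.+1 u v) @ \oo --> pi v.
    by rewrite (cvg_shiftS (fun k => L k u v)); exact: L_cvg.
  apply/esym/(cvg_unique _ cvgS) => //.
  rewrite (_ : (fun k => _) = fun k => \sum_w L k u w * K w v).
    by apply: cvg_fin_sum => w; apply: cvgM; [exact: L_cvg|exact: cvg_cst].
  by apply/funext => k; rewrite LS.
Qed.

Lemma stationary_iter (pi' : S -> R) k :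
  (forall v, \sum_w pi' w * K w v = pi' v) ->
  forall v, \sum_u pi' u * L k u v = pi' v.
Proof.
move=> st; elim: k => [|k IH] v.
  rewrite (bigD1 v)//= L0 eqxx mulr1 big1 ?addr0// => u uv.
  by rewrite L0 (negPf uv) mulr0.
rewrite -[RHS]st.
under eq_bigr do rewrite LS mulr_sumr.
rewrite exchange_big/=; apply: eq_bigr => w _.
by rewrite -[in RHS]IH mulr_suml; apply: eq_bigr => u _; rewrite mulrA.
Qed.

(** A stationary [pi'] is the mixture of the rows of [L k] with weights [pi'], for
every [k]; these rows all tend to [pi], and the weights add up to 1. *)
Lemma limit_unique (pi' : S -> R) : is_distr pi' ->
  (forall v, \sum_w pi' w * K w v = pi' v) -> pi' = pi.
Proof.
move=> [_ pi'1] st; apply/funext => v.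
have cvgpi : (fun k => \sum_u pi' u * L k u v) @ \oo --> \sum_u pi' u * pi v.
  by apply: cvg_fin_sum => u; apply: cvgM; [exact: cvg_cst|exact: L_cvg].
rewrite -mulr_suml pi'1 mul1r in cvgpi.
apply: (cvg_unique _ _ cvgpi) => //.
rewrite (_ : (fun k => _) = fun=> pi' v); first exact: cvg_cst.
by apply/funext => k; rewrite stationary_iter.
Qed.

Lemma tv_dist_le (f g : S -> R) : tv_dist f g <= \sum_v `|f v - g v|.
Proof.
apply: bigmax_le; first exact: sumr_ge0.
move=> A _; rewrite -sumrB (le_trans (ler_norm_sum _ _ _))//.
rewrite [leLHS]big_mkcond ler_sum// => v _; by case: ifP.
Qed.

(** On a finite set the total variation distance is at most the sum of the
pointwise gaps, and there are finitely many initial states. *)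
Lemma limit_uniform :
  (fun k => \big[Num.max/0]_u tv_dist (L k u) pi) @ \oo --> (0 : R).
Proof.
apply: (@squeeze_cvgr _ _ _ _ (fun=> 0)
  (fun k => \sum_u \sum_v `|L k u v - pi v|)).
- apply: nearW => k; rewrite bigmax_ge_id /=.
  apply: bigmax_le => [|u _]; first by apply: sumr_ge0 => u _; exact: sumr_ge0.
  rewrite (bigD1 u)//= -[leLHS]addr0 lerD ?tv_dist_le//.
  by apply: sumr_ge0 => w _; exact: sumr_ge0.
- exact: cvg_cst.
- have zero : \sum_(u : S) \sum_(v : S) `|pi v - pi v| = 0.
    by rewrite big1// => u _; rewrite big1// => v _; rewrite subrr normr0.
  rewrite -[X in _ --> X]zero.
  apply: cvg_fin_sum => u; apply: cvg_fin_sum => v.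
  by apply: cvg_norm; apply: cvgB; [exact: L_cvg|exact: cvg_cst].
Qed.

End FiniteChain.

(** * Events determined by finitely many arrivals *)

Section TotalProbability.
Variables (d : measure_display) (T : measurableType d) (R : realType).
Variable P : probability T R.

Lemma total_probability (F : finType) (f : T -> F) (E : set T) :
  (forall a, measurable (E `&` [set t | f t = a])) ->
  measurable E /\ P E = (\sum_a P (E `&` [set t | f t = a]))%E.
Proof.
move=> mEf.
have EE : E = \bigcup_(a in [set` enum F]) (E `&` [set t | f t = a]).
  apply/seteqP; split=> [t Et|t [a _ []]//].
  by exists (f t) => //=; rewrite mem_enum.
have fF : finite_set [set` enum F] by exact: finite_seq.
split; first by rewrite EE; apply: fin_bigcup_measurable.
rewrite {1}EE measure_fin_bigcup//; last first.
  by move=> a b _ _ [t [[_ /= <-] [_ /= <-]]].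
by rewrite -fsbig_seq ?enum_uniq// big_enum.
Qed.

End TotalProbability.

Section Cylinders.
Variables (R : realType) (V : finType) (e : rel V) (phi : policy e R).
Variables (mu : V -> R) (d : measure_display) (T : measurableType d).
Variables (P : probability T R) (X : int -> T -> arrival e).
Hypothesis X_iid : iid_arrivals phi mu P X.

Local Notation law := (arrival_law phi mu).
Local Notation path := (int -> arrival e).

(** The probability that [m] independent arrivals form a sequence satisfying [Q].
The recursion on [m] makes product formulas provable by induction. *)
Fixpoint weight (m : nat) (Q : seq (arrival e) -> bool) : R :=
  if m is m'.+1 then \sum_a law a * weight m' (fun s => Q (a :: s))
  else (Q [::])%:R.

Lemma weight_cat m k (Q1 Q2 : seq (arrival e) -> bool) :
  weight (m + k) (fun s => Q1 (take m s) && Q2 (drop m s)) =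
  weight m Q1 * weight k Q2.
Proof.
elim: m Q1 => [|m IH] Q1 /=; last first.
  rewrite mulr_suml; apply: eq_bigr => a _; rewrite -mulrA.
  by rewrite -(IH (fun s => Q1 (a :: s))).
rewrite add0n.
have -> : (fun s => Q1 (take 0 s) && Q2 (drop 0 s)) =
          (fun s => Q1 [::] && Q2 s).
  by apply/funext => s; rewrite take0 drop0.
case: (Q1 [::]) => /=; first by rewrite mul1r.
rewrite mul0r; elim: k {Q2} => //= k IHk.
by rewrite big1// => a _; rewrite IHk mulr0.
Qed.

(** The coordinates in [J] are moved one at a time to [I], by summing over the
value of the arrival of that index; when [J] is exhausted the event is a
product event, whose probability is given by independence. *)
Lemma cylinder_weight_aux (J I : seq int) (A : int -> {set arrival e})
    (Q : seq (arrival e) -> bool) : uniq (I ++ J) ->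
  let E := [set t | (forall n, n \in I -> X n t \in A n) /\
                    Q [seq X n t | n <- J]] in
  measurable E /\
  P E = ((\prod_(n <- I) \sum_(a in A n) law a) * weight (size J) Q)%:E.
Proof.
case: X_iid => mX lawX indX.
elim: J I A Q => [|j J IH] I A Q /=.
  rewrite cats0 => uI; case: (Q [::]) => /=; last first.
    rewrite (_ : [set t | _] = set0); last by apply/seteqP; split=> t //= [].
    by rewrite mulr0 measure0.
  rewrite (_ : [set t | _] = \bigcap_(n in [set` I]) (X n @^-1` [set` A n])).
    split; first by apply: fin_bigcap_measurable.
    rewrite indX// mulr1; congr (_%:E); apply: eq_bigr => n _.
    by rewrite lawX.
  apply/seteqP; split=> t /=; first by move=> [h _] n /h.
  by move=> h; split => // n nI; exact: h.
move=> uIJ; set E := [set t | _].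
(* The condition on I, strengthened by fixing the arrival of index j. *)
pose A' a n := if n == j then [set a]%SET else A n.
pose E' a := [set t | (forall n, n \in j :: I -> X n t \in A' a n) /\
                      Q (a :: [seq X n t | n <- J])].
have jI : j \notin I.
  by move: uIJ; rewrite cat_uniq /= negb_or => /and3P[_ /andP[]].
have EE' a : E `&` [set t | X j t = a] = E' a.
  apply/seteqP; split=> t /=.
    move=> [[At Qt] <-]; split=> // n; rewrite inE => /orP[/eqP->|nI].
      by rewrite /A' eqxx finset.inE.
    by rewrite /A' ifN ?At//; apply: contraNneq jI => <-.
  move=> [At Qt]; have aE : X j t = a.
    have := At j (mem_head _ _).
    by rewrite /A' eqxx => /set1P.
  split=> //; split; last by rewrite aE.
  move=> n nI; have := At n; rewrite inE nI orbT /A' ifN; first exact.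
  by apply: contraNneq jI => <-.
have uIJ' : uniq ((j :: I) ++ J).
  by rewrite cat_cons -cat1s uniq_catCA.
have IH' a := IH (j :: I) (A' a) (fun s => Q (a :: s)) uIJ'.
have [a|mE ->] := total_probability P (f := X j) (E := E).
  by rewrite EE'; case: (IH' a).
split=> //.
rewrite mulr_sumr -sumEFin; apply: eq_bigr => a _; rewrite EE'.
case: (IH' a) => _ ->; congr (_%:E); rewrite big_cons mulrCA mulrA.
congr (_ * _ * _).
  by rewrite /A' eqxx big_set1.
rewrite !big_seq; apply: eq_bigr => n nI.
by rewrite /A' ifN//; apply: contraNneq jI => <-.
Qed.

Lemma cylinder_weight (J : seq int) (Q : seq (arrival e) -> bool) : uniq J ->
  measurable [set t | Q [seq X n t | n <- J]] /\
  P [set t | Q [seq X n t | n <- J]] = (weight (size J) Q)%:E.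
Proof.
move=> uJ; have /= := @cylinder_weight_aux J [::] (fun=> finset.set0) Q uJ.
rewrite big_nil mul1r.
rewrite (_ : [set t | _ /\ _] = [set t | Q [seq X n t | n <- J]])//.
by apply/seteqP; split=> t //= [].
Qed.

Definition determined_by (J : seq int) (D : set path) : Prop :=
  forall x y : path, {in J, x =1 y} -> D x -> D y.

Definition event (D : set path) : set T := [set t | D (X^~ t)].

(** Turns a condition on paths into a test on finite sequences, the form of event
to which [cylinder_weight] applies. *)
Lemma determined_code J D : determined_by J D ->
  exists Q : seq (arrival e) -> bool, forall x, D x <-> Q [seq x n | n <- J].
Proof.
move=> detD; exists (fun s => `[< exists2 x, s = [seq x n | n <- J] & D x >]).
move=> x; split=> [Dx|/asboolP[y xy Dy]]; first by apply/asboolP; exists x.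
by apply: detD Dy => n nJ; move/eq_in_map: xy => ->.
Qed.

Lemma event_measurable J D : uniq J -> determined_by J D ->
  measurable (event D).
Proof.
move=> uJ /determined_code[Q DQ].
rewrite /event (_ : [set t | _] = [set t | Q [seq X n t | n <- J]]).
  by case: (cylinder_weight Q uJ).
by apply/seteqP; split=> t /= /DQ.
Qed.

(** Mutual independence of the arrivals is assumed for product events only; the
weights extend it to arbitrary events on disjoint lists of indices. *)
Lemma event_indep J K D E : uniq (J ++ K) -> determined_by J D ->
  determined_by K E ->
  P (event (D `&` E)) = (P (event D) * P (event E))%E.
Proof.
move=> uJK /determined_code[Q1 DQ1] /determined_code[Q2 DQ2].
have /and3P[uJ _ uK] : [&& uniq J, ~~ has (mem J) K & uniq K].
  by rewrite -cat_uniq.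
rewrite /event.
rewrite (_ : [set t | D _] = [set t | Q1 [seq X n t | n <- J]]); last first.
  by apply/seteqP; split=> t /= /DQ1.
rewrite (_ : [set t | E _] = [set t | Q2 [seq X n t | n <- K]]); last first.
  by apply/seteqP; split=> t /= /DQ2.
have [_ ->] := cylinder_weight Q1 uJ.
have [_ ->] := cylinder_weight Q2 uK.
rewrite -EFinM -weight_cat -size_cat.
have [_ <-] := cylinder_weight
  (fun s => Q1 (take (size J) s) && Q2 (drop (size J) s)) uJK.
congr (P _); apply/seteqP; split=> t /=;
  rewrite map_cat take_size_cat ?drop_size_cat ?size_map//.
  by move=> [/DQ1-> /DQ2->].
by move=> /andP[/DQ1 ? /DQ2].
Qed.

(** * The law of the finite-buffer chain *)

Section Chain.
Variable C : nat.
Implicit Types u v : state e C.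

Lemma run_local (x y : path) j k u :
  {in window (2 * j) k.*2, x =1 y} -> run phi x j k u = run phi y j k u.
Proof.
elim: k => //= k IH xy; rewrite IH; last first.
  by move=> n; rewrite mem_window => nk; apply: xy; rewrite mem_window; lia.
by congr Defs.next; apply: xy; rewrite mem_window; lia.
Qed.

Lemma run_event_local j k u v :
  determined_by (window (2 * j) k.*2) [set x | run phi x j k u = v].
Proof. by move=> x y xy /= <-; apply/esym/run_local. Qed.

Lemma pair_law v u' (m : int) :
  P (event [set x | Defs.next phi v (x (2 * m)) (x (2 * m + 1)) = u']) =
  (Defs.kernel phi mu v u')%:E.
Proof.
pose Q (s : seq (arrival e)) :=
  if s is [:: a; b] then Defs.next phi v a b == u' else false.
have uJ : uniq [:: 2 * m; 2 * m + 1] by rewrite /= inE andbT; lia.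
have [_ PQ] := cylinder_weight Q uJ.
transitivity (P [set t | Q [seq X n t | n <- [:: 2 * m; 2 * m + 1]]]).
  by congr (P _); apply/seteqP; split=> t /= /eqP.
rewrite PQ; congr _%:E; rewrite /= /Defs.kernel [RHS]big_mkcond /=.
rewrite -(pair_big xpredT xpredT (fun a b =>
  if Defs.next phi v a b == u' then law a * law b else 0)) /=.
apply: eq_bigr => a _; rewrite mulr_sumr; apply: eq_bigr => b _.
by case: (_ == _); rewrite ?(mulr1, mulr0).
Qed.

Definition run_law j k u v : R :=
  fine (P (event [set x | run phi x j k u = v])).

Lemma run_lawE j k u v :
  P (event [set x | run phi x j k u = v]) = (run_law j k u v)%:E.
Proof.
by rewrite /run_law fineK// fin_num_measure//;
  apply: event_measurable (window_uniq _ _) (@run_event_local j k u v).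
Qed.

Lemma run_law0 j u v : run_law j 0 u v = (u == v)%:R.
Proof.
rewrite /run_law /event /=; have [->|/eqP uv] := eqVneq u v.
  suff -> : [set _ : T | v = v] = setT by rewrite probability_setT.
  by apply/seteqP; split.
suff -> : [set _ : T | u = v] = set0 by rewrite measure0.
by apply/seteqP; split.
Qed.

(** The Markov property: the state after [k] pairs is determined by the arrivals
before the next pair, hence independent of it. *)
Lemma run_lawS j k u u' :
  run_law j k.+1 u u' = \sum_v run_law j k u v * Defs.kernel phi mu v u'.
Proof.
apply: EFin_inj; rewrite -run_lawE -sumEFin.
have EE v : event [set x | run phi x j k.+1 u = u'] `&`
            [set t | run phi (X^~ t) j k u = v] =
  event ([set x | run phi x j k u = v] `&`
         [set x | Defs.next phi v (x (2 * (j + k%:Z)))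
                                  (x (2 * (j + k%:Z) + 1)) = u']).
  rewrite /event; apply/seteqP; split=> t /= [].
    by move=> <- <-.
  by move=> -> <-.
have det v : determined_by (window (2 * (j + k%:Z)) 2)
   [set x | Defs.next phi v (x (2 * (j + k%:Z)))
                            (x (2 * (j + k%:Z) + 1)) = u'].
  by move=> x y xy /= <-; rewrite !xy// mem_window; lia.
have uJ : uniq (window (2 * j) k.*2 ++ window (2 * (j + k%:Z)) 2).
  by apply: window_cat_uniq; lia.
have [v|_ ->] := total_probability P
  (f := fun t => run phi (X^~ t) j k u)
  (E := event [set x | run phi x j k.+1 u = u']).
  rewrite EE; apply: (event_measurable uJ) => x y xy /= [xv xu].
  split.
    by apply: run_event_local xv => n nJ; apply: xy; rewrite mem_cat nJ.
  by apply: det xu => n nJ; apply: xy; rewrite mem_cat nJ orbT.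
apply: eq_bigr => v _; rewrite EE (event_indep uJ)//.
  by rewrite run_lawE pair_law.
exact: run_event_local.
Qed.

(** The run from [- k] to 0 and the run from 0 to [k] have the same law: this
compares the algorithm, which looks into the past, with the forward chain. *)
Lemma run_law_stationary j j' k u v : run_law j k u v = run_law j' k u v.
Proof.
elim: k v => [|k IH] v; first by rewrite !run_law0.
by rewrite !run_lawS; apply: eq_bigr => w _; rewrite IH.
Qed.

Lemma run_law_distr j k u : is_distr (run_law j k u).
Proof.
split=> [v|]; first by rewrite fine_ge0.
apply: EFin_inj; rewrite -sumEFin -(probability_setT P).
have [v|_ ->] := total_probability P
  (f := fun t => run phi (X^~ t) j k u) (E := setT).
  rewrite setTI.
  exact: event_measurable (window_uniq _ _) (@run_event_local j k u v).
by apply: eq_bigr => v _; rewrite setTI -run_lawE.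
Qed.

End Chain.

(** * Erasing words are met almost surely *)

Section Algorithm.
Hypothesis mu_distr : is_distr mu.
Variable p : nat.

Lemma law_letter (F : V -> R) : \sum_a law a * F a.1 = \sum_v mu v * F v.
Proof.
rewrite /arrival_law -(pair_bigA _ (fun v s => mu v * nu phi s * F v))/=.
apply: eq_bigr => v _; rewrite -mulr_suml -mulr_sumr.
by have [_ ->] := nu_distr phi; rewrite mulr1.
Qed.

Lemma law_sum1 : \sum_a law a = 1.
Proof.
have [_ <-] := mu_distr.
under [RHS]eq_bigr do rewrite -[mu _]mulr1.
by rewrite -(law_letter (fun=> 1)); under [RHS]eq_bigr do rewrite mulr1.
Qed.

Lemma weight_letters z :
  weight (size z) (fun s => [seq a.1 | a <- s] == z) = \prod_(v <- z) mu v.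
Proof.
elim: z => [|v z IH]; first by rewrite big_nil.
rewrite big_cons -IH /=.
rewrite (eq_bigr (fun a => law a * ((a.1 == v)%:R *
  weight (size z) (fun s => [seq b.1 | b <- s] == z)))).
  rewrite (law_letter (fun w => (w == v)%:R * _)) (bigD1 v)//= eqxx mul1r.
  by rewrite big1 ?addr0// => w /negPf->; rewrite mul0r mulr0.
move=> a _; congr (_ * _).
have := @weight_cat 0 (size z) (fun=> a.1 == v)
  (fun s => [seq b.1 | b <- s] == z).
rewrite add0n /= => <-; congr weight; apply/funext => s.
by rewrite drop0 eqseq_cons.
Qed.

Lemma weight_positive m : weight m (all (fun a => 0 < nu phi a.2)) = 1.
Proof.
elim: m => //= m IH; rewrite -[RHS]law_sum1; apply: eq_bigr => a _.
have [nu0 _] := nu_distr phi.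
have [a0|] := boolP (0 < nu phi a.2); first by rewrite IH mulr1.
rewrite -leNgt => a0.
rewrite (_ : law a = 0) ?mul0r// /arrival_law.
by rewrite (_ : nu phi a.2 = 0) ?mulr0//; apply/eqP; rewrite eq_le a0 nu0.
Qed.

Lemma prob_drawn n (z : p.*2.-tuple V) :
  P (event [set x | drawn_word p x n = z]) = (\prod_(v <- z) mu v)%:E.
Proof.
have [_ PQ] := cylinder_weight (fun s => [seq a.1 | a <- s] == z)
  (window_uniq (2 * - n%:Z) p.*2).
rewrite -weight_letters size_tuple.
rewrite -[X in weight X](size_window (2 * - n%:Z)) -PQ.
congr (P _); apply/seteqP; split=> t /=; rewrite -map_comp.
  by move=> <-; rewrite drawn_wordE.
by move=> /eqP zE; apply: val_inj; rewrite [LHS]drawn_wordE [RHS](esym zE).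
Qed.

Lemma prob_positive a m :
  P (event [set x | positive_prefs phi x (window a m)]) = 1%E.
Proof.
have [_ PQ] := cylinder_weight (all (fun a => 0 < nu phi a.2))
  (window_uniq a m).
rewrite -(weight_positive (size (window a m))) -PQ.
congr (P _); apply/seteqP; split=> t /=; rewrite all_map.
  by move=> pos; apply/allP => n /pos.
by move=> /allP pos n /pos.
Qed.

Variable S2 : {set p.*2.-tuple V}.

Lemma drawn_local n (Q : pred (p.*2.-tuple V)) :
  determined_by (window (2 * - n%:Z) p.*2) [set x | Q (drawn_word p x n)].
Proof.
move=> x y xy /=; suff -> : drawn_word p x n = drawn_word p y n by [].
apply: val_inj; rewrite [LHS]drawn_wordE [RHS]drawn_wordE.
by apply/eq_in_map => i /xy ->.
Qed.

(** Only the depths that are multiples of [p] are looked at: the words there do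
not overlap, whereas the words at consecutive depths may. *)
Definition blocks_miss m : set path :=
  [set x | forall i, (0 < i <= m)%N -> drawn_word p x (i * p) \notin S2].

Lemma blocks_miss_local m :
  determined_by (window (2 * - (m * p)%N%:Z) (m * p).*2) (blocks_miss m).
Proof.
move=> x y xy miss i im.
rewrite -(@drawn_word_local _ _ _ x y (i * p) (m * p))//.
  exact: miss.
by rewrite leq_pmull ?leq_mul2r; lia.
Qed.

(** The next block lies before all the previous ones, so it is independent of
them; to avoid [S2] it must at least differ from [z]. *)
Lemma blocks_miss_prob m (z : p.*2.-tuple V) : z \in S2 ->
  (P (event (blocks_miss m)) <= ((1 - \prod_(v <- z) mu v) ^+ m)%:E)%E.
Proof.
move=> zS; elim: m => [|m IH].
  rewrite expr0; apply: probability_le1.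
  by apply: event_measurable (window_uniq _ _) (@blocks_miss_local 0).
pose E := [set x : path | drawn_word p x (m.+1 * p) \notin S2].
have -> : blocks_miss m.+1 = E `&` blocks_miss m.
  apply/seteqP; split=> x /= miss.
    by split; [apply: miss; lia|move=> i im; apply: miss; lia].
  move=> i im; case: miss => xE xm; have [->//|im'] := eqVneq i m.+1.
  by apply: xm; lia.
have detE := @drawn_local (m.+1 * p) [pred w | w \notin S2].
rewrite (event_indep _ detE (@blocks_miss_local m)); last first.
  by apply: window_cat_uniq; lia.
rewrite exprS EFinM; apply: lee_pmul => //.
rewrite EFinB -(prob_drawn (m.+1 * p) z).
have detz := @drawn_local (m.+1 * p) (pred1 z).
have mz := event_measurable (window_uniq _ _) detz.
have -> : event [set x : path | drawn_word p x (m.+1 * p) = z] =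
          event [set x | pred1 z (drawn_word p x (m.+1 * p))].
  by apply/seteqP; split=> t /= /eqP.
rewrite -(probability_setC _ mz); apply: le_measure.
- by rewrite inE; apply: event_measurable (window_uniq _ _) detE.
- by rewrite inE; apply: measurableC.
- by move=> t tE /eqP tz; move: tE; rewrite /event /E /= tz zS.
Qed.

Lemma hit_local k :
  determined_by (window (2 * - k%:Z) k.*2) (hit S2 k).
Proof.
move=> x y xy [m pmk mS]; exists m => //.
by rewrite -(drawn_word_local pmk xy).
Qed.

Definition miss_prob k : R := fine (P (event (~` hit S2 k))).

Lemma miss_local k :
  determined_by (window (2 * - k%:Z) k.*2) (~` hit S2 k).
Proof.
move=> x y xy nx hy; apply: nx; apply: hit_local hy => n nw.
by rewrite xy.
Qed.

Hypothesis mu_full : forall v, 0 < mu v.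

(** Full support gives every word a positive probability, and up to the depth
[m * p] there are [m] independent blocks. *)
Lemma miss_prob_cvg0 : S2 != finset.set0 -> miss_prob @ \oo --> (0 : R).
Proof.
case/finset.set0Pn => z zS; set r := 1 - \prod_(v <- z) mu v.
have [mu0 mu1] := mu_distr.
have mu_le1 v : mu v <= 1.
  by rewrite -mu1 (bigD1 v)//= lerDl sumr_ge0.
have r01 : 0 <= r < 1.
  rewrite /r subr_ge0 gtrBl prodr_gt0// andbT.
  by rewrite prodr_ile1// => v _; rewrite mu0 mu_le1.
have miss_le m k : (m * p <= k)%N -> miss_prob k <= r ^+ m.
  move=> mpk; rewrite -lee_fin fineK; last first.
    rewrite fin_num_measure//.
    exact: event_measurable (window_uniq _ _) (@miss_local k).
  apply: le_trans (blocks_miss_prob m zS); apply: le_measure.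
  - rewrite inE.
    exact: event_measurable (window_uniq _ _) (@miss_local k).
  - rewrite inE.
    exact: event_measurable (window_uniq _ _) (@blocks_miss_local m).
  - move=> t nh i im; apply/negP => iS; apply: nh; exists (i * p)%N => //.
    by rewrite leq_pmull ?(leq_trans _ mpk) ?leq_mul2r; lia.
apply/cvgrPdist_lt => eps eps0.
have rm : (geometric 1 r) @ \oo --> (0 : R).
  by apply: cvg_geometric; rewrite ger0_norm; case/andP: r01.
have /cvgrPdist_lt/(_ _ eps0)[m _ /(_ m (leqnn m))] := rm.
rewrite sub0r normrN /= mul1r => rme.
exists (m * p)%N => // k /= /miss_le kr.
rewrite sub0r normrN ger0_norm ?fine_ge0//.
by apply: le_lt_trans kr _; apply: le_lt_trans rme; exact: ler_norm.
Qed.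

(** * The law of the output is the limit law of the chain *)

Section Convergence.
Variable C : nat.
Implicit Types u v : state e C.

Lemma stops_at_local n : determined_by (window (2 * - n%:Z) n.*2)
  [set x | stops_at S2 x n].
Proof.
move=> x y xy [pn nS least]; split=> // [|m /andP[pm mn]].
  by rewrite -(drawn_word_local _ xy)// pn leqnn.
by rewrite -(drawn_word_local _ xy) ?least ?pm// ltnW.
Qed.

Lemma stops_at_measurable n : measurable (event [set x | stops_at S2 x n]).
Proof. exact: event_measurable (window_uniq _ _) (@stops_at_local n). Qed.

Lemma terminates_measurable : measurable (event [set x | terminates S2 x]).
Proof.
have -> : event [set x | terminates S2 x] =
          \bigcup_n event [set x | stops_at S2 x n].
  by apply/seteqP; split=> t [n]; [exists n|exists n].
by apply: bigcup_measurable => n _; exact: stops_at_measurable.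
Qed.

Lemma returns_measurable u :
  measurable (event [set x | returns phi S2 x u]).
Proof.
pose D n := [set x : path | stops_at S2 x n /\
  u = run phi x (- n%:Z + p%:Z) (n - p) (state0 e C)].
have -> : event [set x | returns phi S2 x u] = \bigcup_n event (D n).
  by apply/seteqP; split=> t [n]; [exists n|move=> _ []; exists n].
apply: bigcup_measurable => n _.
apply: (event_measurable (window_uniq (2 * - n%:Z) n.*2)) => x y xy [xn uE].
split; first exact: stops_at_local xy xn.
case: xn => pn _ _; rewrite uE; apply: run_local => i; rewrite mem_window => iw.
by apply: xy; rewrite mem_window; lia.
Qed.

Lemma prob_le_union (A B M N : set T) : measurable A -> measurable B ->
  measurable M -> measurable N -> P N = 0%E -> A `<=` B `|` (M `|` N) ->
  fine (P A) <= fine (P B) + fine (P M).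
Proof.
move=> mA mB mM mN N0 AB.
rewrite -lee_fin EFinD !fineK ?fin_num_measure//.
apply: (le_trans (y := P (B `|` (M `|` N)))).
  by apply: le_measure => //; rewrite inE//; do 2?apply: measurableU.
apply: le_trans (measureU2 _ mB _) _; first exact: measurableU.
apply: leeD => //; apply: le_trans (measureU2 _ mM mN) _.
by rewrite [X in (_ + X)%E](_ : _ = 0%E) ?adde0.
Qed.

Hypothesis S2_erasing : forall z, z \in S2 -> strong_erasing phi C z.

(** The run begun at [- k] and the algorithm give the same state unless no word
has been met up to [k], or some list of preferences has probability zero. *)
Lemma run_law_close k u u' :
  `|run_law 0 k u u' - fine (P (event [set x | returns phi S2 x u']))|
    <= miss_prob k.
Proof.
rewrite (run_law_stationary 0 (- k%:Z)) /run_law /miss_prob.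
set A := event _; set B := event _; set M := event _.
pose good := event [set x | positive_prefs phi x (window (2 * - k%:Z) k.*2)].
have mA : measurable A.
  exact: event_measurable (window_uniq _ _) (@run_event_local _ (- k%:Z) k u u').
have mB : measurable B := returns_measurable u'.
have mM : measurable M.
  exact: event_measurable (window_uniq _ _) (@miss_local k).
have mgood : measurable good.
  apply: (event_measurable (window_uniq (2 * - k%:Z) k.*2)).
  move=> x y xy pos n nw.
  by rewrite -(xy n nw); exact: (pos n nw).
have good0 : P (~` good) = 0%E.
  by rewrite probability_setC// prob_positive subee.
have [AB BA] : A `<=` B `|` (M `|` ~` good) /\ B `<=` A `|` (M `|` ~` good).
  split=> t tE; have [tg|tg] := pselect (good t); try by right; right.
    have [th|th] := pselect (hit S2 k (X^~ t)); last by right; left.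
    by left; apply/(returns_run S2_erasing u u' th tg).
  have [th|th] := pselect (hit S2 k (X^~ t)); last by right; left.
  by left; apply/(returns_run S2_erasing u u' th tg).
have mN := measurableC mgood.
rewrite ler_norml lerNl opprB !lerBlDl.
rewrite (prob_le_union mA mB mM mN good0 AB) andbT.
by rewrite (prob_le_union mB mA mM mN good0 BA).
Qed.

Hypothesis S2_neq0 : S2 != finset.set0.

Lemma run_law_cvg u u' : run_law 0 k u u' @[k --> \oo] -->
  fine (P (event [set x | returns phi S2 x u'])).
Proof.
apply/cvgrPdist_le => eps eps0.
have /cvgrPdist_le/(_ _ eps0) := miss_prob_cvg0 S2_neq0.
apply: filterS => k; rewrite sub0r normrN => missk.
rewrite distrC.
exact: le_trans (run_law_close k u u') (le_trans (ler_norm _) missk).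
Qed.

Lemma terminates_prob1 : P (event [set x | terminates S2 x]) = 1%E.
Proof.
have mt := terminates_measurable.
suff t0 : P (~` event [set x | terminates S2 x]) = 0%E.
  have := probability_setC P (measurableC mt).
  by rewrite setCK t0 sube0.
have mC := measurableC mt.
have le_miss k : fine (P (~` event [set x | terminates S2 x])) <= miss_prob k.
  apply: fine_le; rewrite ?fin_num_measure//.
    exact: event_measurable (window_uniq _ _) (@miss_local k).
  apply: le_measure; rewrite ?inE//.
    exact: event_measurable (window_uniq _ _) (@miss_local k).
  by move=> t nt h; apply: nt; have [n _ tn] := hit_stops h; exists n.
rewrite -[LHS]fineK ?fin_num_measure//; congr _%:E; apply/eqP.
rewrite eq_le fine_ge0// andbT.
refine (@cvgr_to_ge _ \oo _ _ miss_prob _ _ _ _); first exact: miss_prob_cvg0.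
by apply: nearW => k; exact: le_miss.
Qed.

End Convergence.
End Algorithm.
End Cylinders.

Theorem theorem3 (R : realType) (V : finType) (e : rel V)
    (e_sym : symmetric e) (e_irr : irreflexive e)
    (e_conn : forall i j, connect e i j)
    (phi : policy e R) (mu : V -> R)
    (mu_distr : is_distr mu) (mu_full : forall v, 0 < mu v)
    (d : measure_display) (T : measurableType d) (P : probability T R)
    (X : int -> T -> arrival e) (X_iid : iid_arrivals phi mu P X)
    (C p : nat) (C_gt0 : (0 < C)%N) (p_gt0 : (0 < p)%N)
    (erasing_ex : exists z : p.*2.-tuple V, strong_erasing phi C z) :
  exists pi : state e C -> R,
    [/\ stationary phi mu pi,
        forall pi' : state e C -> R, stationary phi mu pi' -> pi' = pi,
        uniformly_ergodic_to phi P X pi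
      & forall S2 : {set p.*2.-tuple V},
          S2 != finset.set0 ->
          (forall z, z \in S2 -> strong_erasing phi C z) ->
          P [set t | terminates S2 (X^~ t)] = 1%E /\
          (forall u : state e C,
             P [set t | returns phi S2 (X^~ t) u] = (pi u)%:E)].
Proof.
case: erasing_ex => z0 z0_erasing.
pose out (S2 : {set p.*2.-tuple V}) (u : state e C) :=
  fine (P (event X [set x | returns phi S2 x u])).
have out_cvg (S2 : {set p.*2.-tuple V}) : S2 != finset.set0 ->
    (forall z, z \in S2 -> strong_erasing phi C z) ->
    forall u u' : state e C,
      run_law phi P X 0 k u u' @[k --> \oo] --> out S2 u'.
  by move=> S2n0 S2e; exact: (run_law_cvg X_iid mu_distr mu_full S2e S2n0).
pose S0 : {set p.*2.-tuple V} := [set z0]%SET.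
have S0n0 : S0 != finset.set0.
  by apply/finset.set0Pn; exists z0; rewrite finset.inE.
have S0e z : z \in S0 -> strong_erasing phi C z by move=> /finset.set1P ->.
have L0 u v := @run_law0 R V e phi d T P X C 0 u v.
have LS k (u v : state e C) := run_lawS X_iid 0 k u v.
have L_distr k u := run_law_distr X_iid (C := C) 0 k u.
have L_cvg := out_cvg S0 S0n0 S0e.
exists (out S0); split.
- exact: (limit_stationary LS L_distr L_cvg (state0 e C)).
- move=> pi' [pi'_distr pi'_st].
  exact: (limit_unique L0 LS L_cvg pi'_distr pi'_st).
- exact: (limit_uniform L_cvg).
- move=> S2 S2n0 S2e; split.
    exact: (terminates_prob1 X_iid mu_distr mu_full S2n0).
  move=> u; have mret := returns_measurable X_iid S2 u.
  rewrite -[LHS]fineK ?fin_num_measure//; congr _%:E.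
  (* Both output laws are limits of the law of the chain. *)
  exact: (cvg_unique _ (out_cvg S2 S2n0 S2e (state0 e C) u)
                       (L_cvg (state0 e C) u)).
Qed.
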